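(* Let $(G,N)$ be an equal order pair such that $G$ is solvable and $N$ is nilpotent. Then the Fitting height of $G$ is at most $4$.
   Context: All groups are finite. If $G$ is a finite group and $N$ is a proper, nontrivial, normal subgroup of $G$, the pair $(G,N)$ is called an equal order pair if, for every $x \in G \setminus N$, all elements of the coset $xN$ have the same order as $x$. *)

(* Defs.v *)
From mathcomp Require Import all_boot all_fingroup all_solvable.

Set Implicit Arguments.
Unset Strict Implicit.
Unset Printing Implicit Defensive.

Import GroupScope.

Section EqualOrderPair.

Variable gT : finGroupType.
Implicit Types G N : {group gT}.

Definition equal_order_pair G N : Prop :=
  [/\ N <| G, N \proper G, N :!=: 1
    & forall x, x \in G :\: N -> forall y, y \in x *: N -> #[y] = #[x]].

End EqualOrderPair.

(* The upper Fitting series F_0(G) = 1, F_(n+1)(G) / F_n(G) = 'F(G / F_n(G)), *)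
(* built like the upper central series upper_central_at.                      *)
Definition fitting_series n (gT : finGroupType) (A : {set gT}) : {set gT} :=
  iter n (fun B => coset B @*^-1 'F(A / B)) 1.

(* The least n such that F_n(G) = G. As with nil_class, the default value     *)
(* #|G| is taken when there is no such n, i.e., when G is not solvable.       *)
Definition fitting_height (gT : finGroupType) (A : {set gT}) : nat :=
  index A (mkseq (fun n => fitting_series n A) #|A|).

Section FittingHeightTheory.

Variables (gT : finGroupType) (G : {group gT}).

Lemma fitting_series_ex n :
  exists2 H : {group gT}, H <| G & fitting_series n G = H.
Proof.
elim: n => [|n [H nHG eqH]]; first by exists 1%G; rewrite ?normal1.
exists (coset H @*^-1 'F(G / H))%G; last first.
  by rewrite /fitting_series iterS -/(fitting_series n G) eqH.
by rewrite -(quotientGK nHG) cosetpre_normal Fitting_normal.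
Qed.

Lemma fitting_seriesS n (H : {group gT}) : H <| G -> fitting_series n G = H ->
  solvable G -> H \proper G -> H \proper fitting_series n.+1 G.
Proof.
move=> nHG eqH solG ltHG.
rewrite /fitting_series iterS -/(fitting_series n G) eqH properE sub_cosetpre /=.
apply: contraL ltHG => sFH; rewrite properE normal_sub //= negbK.
have F1: 'F(G / H) = 1.
  apply/trivgP; apply: subset_trans (_ : coset H @*^-1 'F(G / H) / H \subset _).
    by rewrite cosetpreK.
  by apply: subset_trans (quotientS H sFH) _; rewrite trivg_quotient.
have := trivg_Fitting (quotient_sol H solG); rewrite F1 eqxx => /esym.
by rewrite -subG1 quotient_sub1 ?normal_norm.
Qed.

Lemma fitting_height_leq n : solvable G ->
  (fitting_height G <= n) = (fitting_series n G == G).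
Proof.
move=> solG.
have big k : (fitting_series k G == G) || (k < #|fitting_series k G|).
  elim: k => [|k /orP[/eqP eqG|ltk]]; first by rewrite cards1 orbT.
    have [H nHG eqH] := fitting_series_ex k.+1.
    have sG: G \subset H.
      rewrite -eqH /fitting_series iterS -/(fitting_series k G) eqG.
      by rewrite sub_cosetpre.
    by rewrite eqH eqEsubset normal_sub ?sG.
  have [H nHG eqH] := fitting_series_ex k.
  have [eqHG|neqHG] := eqVneq (H : {set gT}) G.
    have [K nKG eqK] := fitting_series_ex k.+1.
    have sG: G \subset K.
      rewrite -eqK /fitting_series iterS -/(fitting_series k G) eqH eqHG.
      by rewrite sub_cosetpre.
    by rewrite eqK eqEsubset normal_sub ?sG.
  have ltHG: H \proper G by rewrite properEneq neqHG normal_sub.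
  have := proper_card (fitting_seriesS nHG eqH solG ltHG).
  by rewrite -eqH orbC => /(leq_trans _)-> //; rewrite ltnS.
have up i j : i <= j -> fitting_series i G = G -> fitting_series j G = G.
  move=> /subnKC <- eqi; elim: (j - i) => [|k IHk]; first by rewrite addn0.
  have [K nKG eqK] := fitting_series_ex (i + k.+1).
  rewrite eqK; apply/eqP; rewrite eqEsubset normal_sub //= -eqK addnS.
  rewrite /fitting_series iterS -/(fitting_series (i + k) G) IHk.
  by rewrite sub_cosetpre.
have lastG : fitting_series #|G|.-1 G = G.
  have [H nHG eqH] := fitting_series_ex #|G|.-1.
  case/orP: (big #|G|.-1) => [/eqP //|]; rewrite eqH prednK ?cardG_gt0 // => leGH.
  by apply/eqP; rewrite eqEcard normal_sub.
set s := mkseq (fun n => fitting_series n G) #|G|.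
have Gs : gval G \in s.
  by apply/mapP; exists #|G|.-1; rewrite // mem_iota /= add0n prednK.
have ltG: fitting_height G < #|G|.
  by have:= Gs; rewrite -index_mem size_mkseq.
have eqh : fitting_series (fitting_height G) G = G.
  by have := nth_index 1 Gs; rewrite nth_mkseq.
apply/idP/eqP => [len|eqn]; first exact: up eqh.
rewrite leqNgt; apply/negP => lt.
have := before_find 1 (lt : n < find (pred1 (gval G)) s).
by rewrite nth_mkseq ?(ltn_trans lt) //= eqn eqxx.
Qed.

End FittingHeightTheory.

(* Main.v *)
Require Import Defs.
From mathcomp Require Import all_boot all_fingroup all_solvable.
From mathcomp Require Import ssralg.

Set Implicit Arguments.
Unset Strict Implicit.
Unset Printing Implicit Defensive.

Import GroupScope GRing.Theory FiniteModule.

(** Nontrivial elements of N of order coprime to that of x in G :\: N cannot commute with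
x, since otherwise x N would contain elements of different orders. Hence, for
primes p != r with p dividing #|N|, the quotient R / (R :&: N) of a Sylow
r-subgroup R of G acts semiregularly on 'O_p(N), so it has rank at most 1. Let
M be N when N is not a p-group, and 'O_p(G) when it is: in H := G / M every
'O_r(H) then has rank at most 1, so it is cyclic or has a Frattini quotient of
order 4. As Aut 'O_r(H) is abelian in the first case, and the automorphism
group of a group of order 4 embeds in 'S_3, H^`(2) acts trivially on each
'O_r(H) / 'Phi('O_r(H)). The elements of the solvable group H that do so lie
in 'F(H), so 1, M, the preimage K of 'F(H), K <*> G^`(1) and G form a normal
series of G with nilpotent factors. *)

(** * Semiregular actions of [r]-groups *)

(** Written additively, [K] is an [E]-module. The norm of a nontrivial [c] in [E] takes values fixed
    by [c], so it vanishes. If [E] is not cyclic, these relations give [u *+ r = 0] for all [u],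
    impossible in a nontrivial [r^']-group. *)
Lemma abelian_semiregular_abelem_cyclic (gT : finGroupType) r (E K : {group gT}) :
    prime r -> r.-abelem E -> E \subset 'N(K) -> abelian K -> r^'.-group K ->
  K :!=: 1 -> semiregular K E -> cyclic E.
Proof.
move=> r_pr abelE nKE cKK r'K ntK regE; apply: contraR ntK => ncycE.
have [rE cEE _] := and3P abelE; have [_ Er1] := abelemP r_pr abelE.
have [b Eb nt_b]: exists2 b, b \in E & b != 1.
  by apply/trivgPn; apply: contraNneq ncycE => ->; apply: cyclic1.
have [a Ea not_ba]: exists2 a, a \in E & a \notin <[b]>.
  apply/subsetPn; apply: contra ncycE => sEb.
  by apply/cyclicP; exists b; apply/eqP; rewrite eqEsubset sEb cycle_subG.
have nK x : x \in E -> x \in 'N(K) by apply: (subsetP nKE).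
have actX (u : fmod_of cKK) x y : x \in E -> y \in E ->
    actr u (x * y) = actr (actr u x) y.
  move=> Ex Ey; apply: val_inj.
  by rewrite /= !fmvalJ ?groupM ?nK ?conjgM.
have norm0 (u : fmod_of cKK) c : c \in E -> c != 1 ->
    (\sum_(i < r) actr u (c ^+ i) = 0)%R.
  move=> Ec nt_c; set w := (\sum_(i < r) _)%R.
  (* Since [c ^+ r = 1], acting by [c] permutes the summands cyclically. *)
  have fix_w: actr w c = w.
    rewrite /w actr_sum -(prednK (prime_gt0 r_pr)).
    rewrite big_ord_recr big_ord_recl /= addrC; congr (_ + _)%R.
      by rewrite -actX ?groupX // -expgSr prednK ?prime_gt0 // Er1.
    by apply: eq_bigr => i _; rewrite -actX ?groupX // -expgSr.
  have: val w \in 'C_K[c].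
    rewrite inE fmodP; apply/cent1P/commgP/conjg_fixP.
    by rewrite -fmvalJ ?nK // fix_w.
  rewrite regE => [/set1P w1|]; first exact: val_inj.
  by rewrite !inE nt_c.
(* Summing the vanishing norms of a * b ^+ j over j leaves u *+ r: for each *)
(* i != 0, the terms (a * b ^+ j) ^+ i add up to the norm of b ^+ i.        *)
have rK0 (u : fmod_of cKK) : (u *+ r = 0)%R.
  have <-: (\sum_(j < r) \sum_(i < r) actr u ((a * b ^+ j) ^+ i) = 0)%R.
    apply: big1 => j _; apply: norm0; first by rewrite groupM ?groupX.
    apply: contra not_ba => /eqP/(canRL (mulgK _))->.
    by rewrite mul1g groupV mem_cycle.
  rewrite exchange_big /=.
  transitivity (\sum_(i < r) if val i == 0 then u *+ r else 0)%R.
    rewrite (bigD1 (Ordinal (prime_gt0 r_pr))) //= big1 ?addr0 // => i.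
    by rewrite -val_eqE => /negPf /= ->.
  apply: eq_bigr => k _; case: ifPn => [/eqP->|]; last rewrite -lt0n => k_gt0.
    rewrite -[X in (_ *+ X)%R]card_ord -sumr_const; apply: eq_bigr => j _.
    by apply: val_inj; rewrite /= fmvalJ ?conjg1 // group1.
  have commab j : commute a (b ^+ j) by apply: (centsP cEE); rewrite ?groupX.
  rewrite (eq_bigr (fun j : 'I__ => actr (actr u (a ^+ k)) ((b ^+ k) ^+ j))).
    rewrite norm0 ?groupX // -order_dvdn (abelem_order_p abelE Eb nt_b).
    by rewrite gtnNdvd.
  by move=> j _; rewrite expgMn // -actX ?groupX // -!expgM mulnC.
rewrite -subG1; apply/subsetP=> x Kx; apply/set1P.
have coKr: coprime #|K| r by rewrite coprime_sym prime_coprime // -p'natE.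
by rewrite -(expgK coKr Kx) -(fmodK cKK Kx) -fmvalZ rK0 fmval0 expg1n.
Qed.

(** The abelian case applies to the centre of [K], nontrivial by nilpotence, and to a rank 2
    elementary abelian subgroup of [R]. *)
Lemma nilpotent_semiregular_p_rank (gT : finGroupType) r (R K : {group gT}) :
    prime r -> R \subset 'N(K) -> nilpotent K -> r^'.-group K -> K :!=: 1 ->
  semiregular K R -> 'r_r(R) <= 1.
Proof.
move=> r_pr nKR nilK r'K ntK regR; rewrite leqNgt; apply/negP=> /p_rank_geP[E].
case/pnElemP=> sER abelE dimE.
have: cyclic E.
  apply: (@abelian_semiregular_abelem_cyclic _ r E 'Z(K)) => //.
  - by rewrite (subset_trans sER) // gFnorm_trans.
  - exact: center_abelian.
  - exact: pgroupS (center_sub K) r'K.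
  - by rewrite /= center_nil_eq1.
  exact: semiregularS (center_sub K) sER regR.
by rewrite (abelem_cyclic abelE) dimE.
Qed.

(** * Coprime action and the Fitting subgroup *)

(** Coprimeness lifts the trivial action on [Q / 'Phi(Q)] to ['Phi(Q) <*> 'C_Q(A) = Q], and elements
    of ['Phi(Q)] are nongenerators. *)
Lemma coprime_cent_Phi (gT : finGroupType) (r : nat) (Q A : {group gT}) :
    r.-group Q -> coprime #|Q| #|A| -> [~: Q, A] \subset 'Phi(Q) ->
  A \subset 'C(Q).
Proof.
move=> rQ coQA sRPhi.
have nQA : A \subset 'N(Q).
  by rewrite -commg_subl (subset_trans sRPhi) ?Phi_sub.
have nPA : A \subset 'N('Phi(Q)) := gFnorm_trans _ nQA.
have nPQ : Q \subset 'N('Phi(Q)) := gFnorm _ _.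
have coPA : coprime #|'Phi(Q)| #|A| := coprimeSg (Phi_sub Q) coQA.
have /= defC := coprime_norm_quotient_cent nQA nPA coPA
  (pgroup_sol (pgroupS (Phi_sub Q) rQ)).
have defQ: 'Phi(Q) <*> 'C_Q(A) = Q.
  apply/eqP; rewrite eqEsubset join_subG Phi_sub subsetIl /=.
  rewrite -(quotientSGK nPQ) ?joing_subl //.
  rewrite quotientYidl ?(subset_trans _ nPQ) ?subsetIl //.
  by rewrite defC subsetI subxx quotient_cents2r // commGC.
have := Phi_nongen defQ; rewrite genGid => /setIidPl.
by rewrite centsC.
Qed.

(** Otherwise [F * W] contains a normal subgroup [L] of [G] with [L / F] a nontrivial elementary
    abelian [s]-group. A Sylow [s]-subgroup [S] of [L :&: W] centralises ['O_s^'(F)] by coprime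
    action, so [L = F * S] is nilpotent and lies in [F]. *)
Lemma stab_Fitting_Phi (gT : finGroupType) (G W : {group gT}) :
    solvable G -> W <| G ->
    (forall r, prime r -> [~: 'O_r(G), W] \subset 'Phi('O_r(G))) ->
  W \subset 'F(G).
Proof.
move=> solG nsWG stabW; have [sWG nWG] := andP nsWG.
set F := 'F(G); have nsFG: F <| G := Fitting_normal G; have [sFG nFG] := andP nsFG.
have nilF : nilpotent F := Fitting_nil G.
apply: contraT; rewrite -quotient_sub1 ?(subset_trans sWG) // subG1 => ntWF.
have [E [sEW nsEG ntE /is_abelemP[s s_pr abelE]]] :=
  solvable_norm_abelem (quotient_sol _ (solvableS sWG solG))
    (quotient_normal F nsWG) ntWF.
have [L defE sFL nsLG] := inv_quotientN nsFG nsEG.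
have [sLG nLG] := andP nsLG; have nFL := subset_trans sLG nFG.
have sLFW: L \subset F * W.
  by rewrite -quotientSK // -defE.
have [S sylS] := Sylow_exists s (L :&: W).
have [sSLW sS _] := and3P sylS.
have [sSL sSW] := subsetIP sSLW; have sSG := subset_trans sSL sLG.
have nFS := subset_trans sSL nFL.
(* [L / F] is an [s]-group and the image of [L :&: W], so the image of [S] is all of it. *)
have defL: F * S = L.
  apply/eqP; rewrite eqEsubset mul_subG //= -quotientSK //.
  have ->: L / F = (L :&: W) / F.
    by rewrite -[RHS]quotientMidl setIC group_modl // (setIidPr sLFW).
  have /and3P[_ _] := quotient_pHall nFS sylS.
  rewrite p'natE // => s'i.
  have: s.-nat #|(L :&: W) / F : S / F|.
    apply: pnat_dvd (dvdn_indexg _ _) _; apply: pgroupS (abelem_pgroup abelE).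
    by rewrite defE quotientS ?subsetIl.
  move=> si; rewrite -indexg_eq1; apply/eqP/(@pnat_1 s) => //.
  by rewrite p'natE.
have cS : S \subset 'C('O_s^'(F)).
  rewrite centsC -(Sylow_gen 'O_s^'(F)) gen_subG; apply/bigcupsP=> P sylP.
  have sPF : P \subset F.
    by case/andP: sylP => _ /andP[sPO _]; rewrite (subset_trans sPO) ?pcore_sub.
  have [r r_pr rP] := p_groupP (proj1 (andP sylP)).
  have [-> | ntP] := eqsVneq P 1; first exact: sub1G.
  have s'r : r != s.
    have [_ rdvd _] := pgroup_pdiv rP ntP.
    have := pgroupP (pcore_pgroup s^' F) r r_pr; apply.
    by apply: dvdn_trans rdvd (cardSg _); case/andP: sylP => _ /andP[].
  have sPO : P \subset 'O_r(G).
    rewrite -p_core_Fitting.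
    by rewrite (sub_normal_Hall (nilpotent_pcore_Hall r nilF) (pcore_normal _ _)).
  rewrite (subset_trans sPO) // centsC.
  apply: (coprime_cent_Phi (pcore_pgroup r G)).
    apply: pnat_coprime (pcore_pgroup r G) _.
    by apply: pi_pnat sS _; rewrite !inE eq_sym.
  exact: subset_trans (commgS _ sSW) (stabW r r_pr).
have nOS : S \subset 'N('O_s(F)) by rewrite gFnorm_trans.
have nilL: nilpotent L.
  have [_ defF cOO _] := dprodP (nilpotent_pcoreC s nilF).
  have defL' : 'O_s^'(F) \* ('O_s(F) <*> S) = L.
    rewrite cprodE; last by rewrite join_subG -(centsC 'O_s^'(F)) cOO cS.
    by rewrite /= norm_joinEr // mulgA (centC cOO) defF defL.
  rewrite (cprod_nil defL') (nilpotentS (pcore_sub _ _) nilF) /=.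
  by rewrite (pgroup_nil (p := s)) //= norm_joinEr // pgroupM pcore_pgroup.
by case/eqP: ntE; rewrite defE; apply/trivgP; rewrite quotient_sub1 // Fitting_max.
Qed.

Lemma der_Aut_cents (gT : finGroupType) (G V : {group gT}) n :
  G \subset 'N(V) -> (Aut V)^`(n) = 1 -> G^`(n) \subset 'C(V).
Proof.
move=> nVG AutV1; have nVGn := subset_trans (der_sub n G) nVG.
rewrite -ker_conj_aut -sub_morphim_pre // morphim_der // -AutV1 dergS //.
exact: Aut_conj_aut.
Qed.

(** A Sylow 3-subgroup has index at most 2, hence is normal; it and its quotient have prime or
    trivial order. *)
Lemma card_dvd6_der2 (gT : finGroupType) (B : {group gT}) :
  #|B| %| 6 -> B^`(2) = 1.
Proof.
move=> dvdB6; have [S sylS] := Sylow_exists 3 B.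
have [sSB _ _] := and3P sylS.
have part6: (6`_3 = 3)%N by rewrite p_part.
have oS: #|S| %| 3 by rewrite (card_Hall sylS) -[X in _ %| X]part6 partn_dvd.
have iS: #|B : S| %| 2.
  rewrite -divgS // (card_Hall sylS) -{1}(partnC 3 (cardG_gt0 B)) mulKn //.
  have p'6: 2 = (6`_3^')%N.
    by apply/eqP; rewrite -(@eqn_pmul2l 3) // -{2}part6 partnC.
  by rewrite [X in _ %| X]p'6 partn_dvd.
have abelian_dvd (aT : finGroupType) (H : {group aT}) q :
    prime q -> #|H| %| q -> abelian H.
  move=> q_pr /(dvdn_pfactor _ 1 q_pr)[m le_m1 oH].
  apply: (@p2group_abelian _ q); first by rewrite /pgroup oH pnatX pnat_id.
  by rewrite oH pfactorK // (leq_trans le_m1).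
have nsSB : S <| B.
  have [_ /(_ _ iS)] := primeP (isT : prime 2); case/pred2P=> iSB.
    move/eqP: iSB; rewrite indexg_eq1 => sBS.
    by rewrite /normal sSB (subset_trans sBS) ?normG.
  exact: index2_normal.
have sB1S: B^`(1) \subset S.
  apply: der1_min; first exact: normal_norm.
  by apply: (abelian_dvd _ _ 2) => //=; rewrite card_quotient ?normal_norm.
apply/trivgP/(subset_trans (dergS 1 sB1S)).
by rewrite (derG1P (abelian_dvd _ S 3 _ _)).
Qed.

(** [Aut V] acts faithfully on the at most three elements of [V^#], so its order divides 6. *)
Lemma card4_der2_cents (gT : finGroupType) (G V : {group gT}) :
  #|V| %| 4 -> G \subset 'N(V) -> G^`(2) \subset 'C(V).
Proof.
move=> oV nVG; apply: der_Aut_cents nVG _.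
have sAutS: Aut V \subset perm.Sym_group V^#.
  apply/subsetP=> f AutVf; rewrite inE; apply/subsetP=> x; rewrite inE /= => fx.
  rewrite !inE; apply/andP; split; apply: contraR fx.
    by rewrite negbK => /eqP->; rewrite -(autmE AutVf) morph1.
  by move/(out_Aut AutVf)->.
apply: card_dvd6_der2; apply: dvdn_trans (cardSg sAutS) _.
have := dvdn_leq (isT : 0 < 4) oV; rewrite perm.card_Sym (cardsD1 1) group1.
by case: #|_| => [|[|[|[|]]]].
Qed.

(** Normal abelian subgroups of [Q] are cyclic, so a noncyclic [Q] is a dihedral, semidihedral or
    quaternion 2-group by classification; in all three families the Frattini subgroup is the derived
    subgroup, of index 4. *)
Lemma rank1_pgroup_Phi_index (gT : finGroupType) (r : nat) (Q : {group gT}) :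
  r.-group Q -> 'r_r(Q) <= 1 -> cyclic Q \/ #|Q / 'Phi(Q)| = 4.
Proof.
move=> rQ rankQ.
have ind4 n x y : 1 < n -> extremal_generators Q 2 n (x, y) ->
    'Phi(Q) = Q^`(1) -> #|Q^`(1)| = (2 ^ n.-2)%N -> #|Q / 'Phi(Q)| = 4.
  move=> n_gt1 [oQ _ _ _] defPhi oQ1.
  rewrite card_quotient ?gFnorm // -divgS ?Phi_sub //= defPhi oQ1 oQ.
  by rewrite -(subnKC n_gt1) -[_.-2]/(n - 2) addnC expnD mulKn ?expn_gt0.
have [X nsXQ cXX|cycQ|] := normal_rank1_structure rQ; [ | by left | ].
  rewrite abelian_rank1_cyclic // (leq_trans (rankS (normal_sub nsXQ))) //.
  by rewrite (rank_pgroup rQ).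
case/and3P=> _ ext _; right.
move: ext; rewrite /extremal2 !inE orbC -orbA; case/or3P; move/eqP.
- case/semidihedral_classP=> m m_gt3 isoM.
  have [[x z] genM [oz _]] := generators_semidihedral m_gt3 isoM.
  case/semidihedral_structure: (genM) => // _ [_ defPhi o1 _] _ _ _.
  by apply: ind4 genM _ _ => //; apply: leq_trans m_gt3.
- case/quaternion_classP=> m m_gt2 isoM.
  have [[x z] genM _] := generators_quaternion m_gt2 isoM.
  case/quaternion_structure: (genM) => // _ [_ defPhi o1 _] _ _ _.
  by apply: ind4 genM _ _ => //; apply: leq_trans m_gt2.
case/dihedral_classP=> m m_gt1 isoM.
have [[x z] genM _] := generators_2dihedral m_gt1 isoM.
case/dihedral2_structure: (genM) => // _ [_ defPhi o1 _] _ _ _.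
by apply: ind4 genM _ _.
Qed.

Lemma der2_sub_Fitting (gT : finGroupType) (G : {group gT}) :
    solvable G -> (forall r, prime r -> 'r_r('O_r(G)) <= 1) ->
  G^`(2) \subset 'F(G).
Proof.
move=> solG rankG; apply: stab_Fitting_Phi (der_normal 2 G) _ => // r r_pr.
set Q := 'O_r(G); have nQG : G \subset 'N(Q) := gFnorm _ _.
have nPG : G \subset 'N('Phi(Q)) := gFnorm_trans _ nQG.
have [cycQ | oQ] := rank1_pgroup_Phi_index (pcore_pgroup r G) (rankG r r_pr).
  have /commG1P: G^`(2) \subset 'C(Q).
    apply: subset_trans (der_sub 1 _) _.
    exact: der_Aut_cents nQG (derG1P (Aut_cyclic_abelian cycQ)).
  by rewrite commGC => ->; apply: sub1G.
rewrite commGC -quotient_cents2 ?gFnorm //; last exact: subset_trans (der_sub 2 G) nPG.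
by rewrite quotient_der // card4_der2_cents ?oQ // quotient_norms.
Qed.

(** * Normal series with nilpotent factors *)

(** With [H] the [n]-th term of the series, [B / H] is an image of [B / A], hence a nilpotent normal
    subgroup of [G / H]. *)
Lemma sub_fitting_seriesS (gT : finGroupType) (G A B : {group gT}) n :
    A <| G -> B <| G -> A \subset fitting_series n G -> nilpotent (B / A) ->
  B \subset fitting_series n.+1 G.
Proof.
move=> /andP[_ nAG] nsBG; have [sBG _] := andP nsBG.
have [H /andP[_ nHG] defH] := fitting_series_ex G n.
rewrite /fitting_series iterS -/(fitting_series n G) defH => sAH nilBA.
have [nAB nHB] := (subset_trans sBG nAG, subset_trans sBG nHG).
rewrite -sub_quotient_pre // Fitting_max ?quotient_normal //.
by have /homgP[f /= <-] := homg_quotientS nAB nHB sAH; apply: morphim_nil.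
Qed.

Lemma fitting_height_le4 (gT : finGroupType) (G M : {group gT}) :
    solvable G -> M <| G -> nilpotent M ->
    (forall r, prime r -> 'r_r('O_r(G / M)) <= 1) ->
  fitting_height G <= 4.
Proof.
move=> solG nsMG nilM rankGM; have [sMG nMG] := andP nsMG.
rewrite fitting_height_leq //.
have [H4 nsH4 defH4] := fitting_series_ex G 4.
rewrite eqEsubset defH4 normal_sub //= -defH4.
pose K := (coset M @*^-1 'F(G / M))%G.
have nsKG : K <| G by rewrite -(quotientGK nsMG) cosetpre_normal Fitting_normal.
have [sKG nKG] := andP nsKG.
pose T := (K <*> G^`(1))%G.
have nsTG : T <| G by rewrite normalY ?der_normal.
have nKG1 := subset_trans (der_sub 1 G) nKG.
apply: (@sub_fitting_seriesS _ G T) => //; last first.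
  by apply/abelian_nil/sub_der1_abelian; rewrite joing_subr.
apply: (@sub_fitting_seriesS _ G K) => //; last first.
  rewrite quotientYidl //; apply/abelian_nil/sub_der1_abelian.
  change (G^`(2) \subset K).
  rewrite -sub_quotient_pre ?(subset_trans (der_sub 2 G)) // quotient_der //.
  exact: der2_sub_Fitting (quotient_sol M solG) rankGM.
apply: (@sub_fitting_seriesS _ G M) => //; last first.
  by rewrite cosetpreK Fitting_nil.
apply: (@sub_fitting_seriesS _ G 1) => //; first exact: normal1.
exact: quotient_nil.
Qed.

(** * Equal order pairs *)

Lemma equal_order_pair_p_rank (gT : finGroupType) (G N R : {group gT}) (p r : nat) :
    equal_order_pair G N -> nilpotent N -> prime r -> p != r -> 'O_p(N) != 1 ->
  r.-Sylow(G) R -> 'r_r(R / (N :&: R)) <= 1.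
Proof.
move=> [nsNG _ _ eqord] nilN r_pr neq_pr ntP sylR.
have [sNG nNG] := andP nsNG; have [sRG rR _] := and3P sylR.
set P := 'O_p(N); have sPN : P \subset N := pcore_sub _ _.
have nPG : G \subset 'N(P) := gFnorm_trans _ nNG.
have pP : p.-group P := pcore_pgroup _ _.
have defK : N :&: R = 'O_r(N).
  exact: nilpotent_Hall_pcore nilN (Sylow_setI_normal nsNG sylR).
rewrite defK; set K := 'O_r(N).
have nKG : G \subset 'N(K) := gFnorm_trans _ nNG.
have r'P : r^'.-group P by apply: pi_pgroup pP _; rewrite !inE.
have tiPK : P :&: K = 1.
  by rewrite setIC coprime_TIg // (pnat_coprime (pcore_pgroup r N)).
have [nKP nKR] := (subset_trans sPN (subset_trans sNG nKG), subset_trans sRG nKG).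
(* [P] is replaced by [P / K], a faithful copy since [P :&: K = 1], on which [R / K] acts by
   conjugation. *)
apply: (@nilpotent_semiregular_p_rank _ r _ (P / K)%G) => //=.
- by rewrite quotient_norms // (subset_trans sRG).
- by rewrite quotient_nil // (nilpotentS sPN).
- exact: quotient_pgroup.
- rewrite -subG1 quotient_sub1 //; apply: contra ntP => /setIidPl.
  by rewrite tiPK => <-.
move=> xK /setD1P[ntx /morphimP[x nKx Rx /= def_xK]]; rewrite {xK}def_xK in ntx *.
have nNx : x \notin N.
  apply: contra ntx => Nx; apply/eqP/coset_id.
  by rewrite /K -defK inE Nx.
have Gx := subsetP sRG x Rx.
apply/trivgP/subsetP=> _ /setIP[/morphimP[y nKy Py ->] /cent1P/commgP].
(* Commuting cosets only place [[~ y, x]] in [K]; it also lies in [P], so it is trivial. *)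
rewrite -morphR //= => /eqP/coset_idr; rewrite groupR // => /(_ isT) Kyx.
have Pyx : [~ y, x] \in P.
  by rewrite commgEl groupMl ?groupV // memJ_norm // (subsetP nPG).
have /commgP/commute_sym cxy : [~ y, x] == 1.
  by apply/eqP/set1P; rewrite -[[set 1]]/(1 : {set gT}) -tiPK inE Pyx.
have oxy : #[x * y] = #[x].
  by apply: eqord; rewrite ?inE ?nNx // mem_lcoset mulKg (subsetP sPN).
have coxy : coprime #[x] #[y].
  by apply: pnat_coprime (mem_p_elt rR Rx) (mem_p_elt r'P Py).
move: oxy; rewrite orderM // -[RHS]muln1 => /eqP.
by rewrite eqn_pmul2l // order_eq1 => /eqP->; rewrite morph1 set11.
Qed.

(** The second isomorphism theorem turns the quotient of [R] into a Sylow [r]-subgroup of [G / M],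
    which contains ['O_r(G / M)]. Keeping [M] apart from [N] allows [M = 'O_p(G)]. *)
Lemma pcore_quotient_p_rank (gT : finGroupType) (G N M R : {group gT}) (r : nat) :
    M <| G -> N :&: R = M :&: R -> r.-Sylow(G) R -> 'r_r(R / (N :&: R)) <= 1 ->
  'r_r('O_r(G / M)) <= 1.
Proof.
move=> nsMG eqMN sylR; have nMR := subset_trans (pHall_sub sylR) (normal_norm nsMG).
rewrite eqMN (isog_p_rank (second_isog nMR)); apply: leq_trans.
by rewrite p_rankS // pcore_sub_Hall // quotient_pHall.
Qed.

Theorem proposition5p3 (gT : finGroupType) (G N : {group gT}) :
  equal_order_pair G N -> solvable G -> nilpotent N -> fitting_height G <= 4.
Proof.
move=> eopGN solG nilN; have [nsNG _ ntN _] := eopGN.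
have ntO p : prime p -> p %| #|N| -> 'O_p(N) != 1.
  move=> p_pr pN; rewrite trivg_card1 (card_Hall (nilpotent_pcore_Hall p nilN)).
  by rewrite partn_eq1 ?cardG_gt0 // p'natE // pN.
have [N1 | [p p_pr p_N]] := trivgVpdiv N; first by rewrite N1 eqxx in ntN.
have [pN | not_pN] := boolP (p.-group N).
  (* The semiregularity argument does not reach [r = p] here; with [M = 'O_p(G)], the group
     ['O_p(G / M)] is trivial. *)
  apply: (@fitting_height_le4 _ G 'O_p(G)) => //.
  - exact: pcore_normal.
  - exact: pgroup_nil (pcore_pgroup p G).
  move=> r r_pr; have [-> | neq_rp] := eqVneq r p.
    by rewrite trivg_pcore_quotient p_rank1.
  have [R sylR] := Sylow_exists r G; have rR := pHall_pgroup sylR.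
  have tiR (H : {group gT}) : p.-group H -> H :&: R = 1.
    move=> pH; rewrite coprime_TIg // coprime_sym (pnat_coprime rR) //.
    by apply: pi_pgroup pH _; rewrite !inE eq_sym.
  apply: (pcore_quotient_p_rank (N := N) (pcore_normal _ _) _ sylR).
    by rewrite !tiR ?pcore_pgroup.
  rewrite eq_sym in neq_rp.
  exact: equal_order_pair_p_rank eopGN nilN r_pr neq_rp (ntO p p_pr p_N) sylR.
apply: (@fitting_height_le4 _ G N) => // r r_pr.
(* Such a [q] is [p] itself or, when [r = p], a prime divisor of the order of ['O_p^'(N)],
   nontrivial as [N] is not a [p]-group. *)
have [q [q_pr qN neq_qr]] : exists q, [/\ prime q, q %| #|N| & q != r].
  have [eq_pr | neq_pr] := eqVneq p r; last by exists p.
  have [O1 | [q q_pr qO]] := trivgVpdiv 'O_p^'(N).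
    case/negP: not_pN; rewrite -(pgroupNK p) -partG_eq1.
    by rewrite -(card_Hall (nilpotent_pcore_Hall p^' nilN)) O1 cards1.
  exists q; split=> //; first exact: dvdn_trans qO (cardSg (pcore_sub _ _)).
  by rewrite -eq_pr; apply: (pgroupP (pcore_pgroup p^' N)).
have [R sylR] := Sylow_exists r G.
apply: (pcore_quotient_p_rank nsNG (erefl _) sylR).
exact: equal_order_pair_p_rank eopGN nilN r_pr neq_qr (ntO q q_pr qN) sylR.
Qed.
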